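(* Suppose $f:X\to Y$ is an ls-continuous map between metric spaces of bounded geometry. If $f$ is coarsely light and $Y$ has Property A, then $X$ has Property A.
   Context: A family $\mathcal{U}$ of subsets of a metric space $X$ is uniformly bounded iff there is $M>0$ with $\mathrm{diam}(U)\le M$ for all $U\in\mathcal{U}$; the ls-structure of $X$ is the set of all uniformly bounded families. A metric space has bounded geometry if for every uniformly bounded cover the cardinalities of its elements are bounded by a common finite number. A map is ls-continuous if it sends uniformly bounded families to uniformly bounded families. For a family $\mathcal{U}$ of subsets of $X$ and $A\subseteq X$, the $\mathcal{U}$-components of $A$ are the equivalence classes of the relation on $A$: $x,x'$ are joined by a finite sequence $x=x_1,\dots,x_k=x'$ in $A$ with each pair $x_i,x_{i+1}$ in a common element of $\mathcal{U}$. For ls-continuous $f:X\to Y$ and uniformly bounded $\mathcal{U}$ in $X$, $\mathcal{V}$ in $Y$, $c(\mathcal{U},f,\mathcal{V})$ is the family of all $\mathcal{U}$-components of sets $f^{-1}(V)$, $V\in\mathcal{V}$. The light structure on $X$ with respect to $f$ is the closure under refinement of the set of all $c(\mathcal{U},f,\mathcal{V})$ (all families each of whose elements with more than one point is contained in an element of one fixed $c(\mathcal{U},f,\mathcal{V})$). The map $f$ is coarsely light if the light structure with respect to $f$ equals the ls-structure of $X$ (equivalently, every $c(\mathcal{U},f,\mathcal{V})$ is uniformly bounded). Property A (Yu): a metric space $X$ of bounded geometry has Property A if for every $R>0$ and $\varepsilon>0$ there are $S>0$ and finite nonempty subsets $A_x\subseteq X\times\mathbb{N}$ ($x\in X$)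 such that $A_x\subseteq B(x,S)\times\mathbb{N}$ for all $x$, and $|A_x\,\triangle\,A_y|<\varepsilon\,|A_x\cap A_y|$ whenever $d(x,y)\le R$. *)

(* Defs.v *)
From mathcomp Require Import all_boot all_order all_algebra finmap.
From mathcomp Require Import boolp classical_sets cardinality reals ereal.
From mathcomp Require Import topology.

Set Implicit Arguments.
Unset Strict Implicit.
Unset Printing Implicit Defensive.

Import Order.TTheory GRing.Theory Num.Theory.

Local Open Scope classical_set_scope.
Local Open Scope ring_scope.

(* A family of subsets of X is a value of type set (set X). *)

(* diam set0 = -oo rather than 0, which makes no difference to the bounds
   diam A <= M with M > 0 below. *)
Definition diam (R : realType) (X : metricType R) (A : set X) : \bar R :=
  ereal_sup [set (mdist p.1 p.2)%:E | p in A `*` A].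

Definition uniformly_bounded (R : realType) (X : metricType R)
    (U : set (set X)) : Prop :=
  exists2 M : R, 0 < M & forall A, U A -> (diam A <= M%:E)%E.

Definition ls_structure (R : realType) (X : metricType R) :
    set (set (set X)) :=
  [set U | uniformly_bounded U].
Arguments ls_structure {R} X.

Definition bounded_geometry (R : realType) (X : metricType R) : Prop :=
  forall U : set (set X), uniformly_bounded U -> \bigcup_(A in U) A = setT ->
    exists n : nat, forall A, U A -> (A #<= `I_n)%card.
Arguments bounded_geometry {R} X.

Definition ls_continuous (R : realType) (X Y : metricType R) (f : X -> Y) :
    Prop :=
  forall U, ls_structure X U -> ls_structure Y [set f @` A | A in U].

Definition in_common_element (T : Type) (U : set (set T)) (x y : T) : Prop :=
  exists2 W, U W & W x /\ W y.

(* The joining sequence x_1, ..., x_k is x :: s; s = [::] gives k = 1. *)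
Definition joined (T : eqType) (U : set (set T)) (A : set T) (x y : T) : Prop :=
  exists s : seq T,
    [/\ forall z, z \in x :: s -> A z,
        path (fun a b => `[< in_common_element U a b >]) x s
      & last x s = y].

Definition components (T : eqType) (U : set (set T)) (A : set T) :
    set (set T) :=
  [set [set y | joined U A x y] | x in A].

Definition component_family (R : realType) (X Y : metricType R)
    (U : set (set X)) (f : X -> Y) (V : set (set Y)) : set (set X) :=
  \bigcup_(B in V) components U (f @^-1` B).

Definition refines (T : Type) (W W' : set (set T)) : Prop :=
  forall A, W A -> (exists x y, [/\ A x, A y & x <> y]) ->
    exists2 B, W' B & A `<=` B.

Definition light_structure (R : realType) (X Y : metricType R) (f : X -> Y) :
    set (set (set X)) :=
  [set W | exists (U : set (set X)) (V : set (set Y)),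
    [/\ uniformly_bounded U, uniformly_bounded V
      & refines W (component_family U f V)]].

Definition coarsely_light (R : realType) (X Y : metricType R) (f : X -> Y) :
    Prop :=
  light_structure f = ls_structure X.

(* Property A is meant for spaces of bounded geometry; that assumption is kept
   as the separate predicate bounded_geometry. *)
Definition property_A (R : realType) (X : metricType R) : Prop :=
  forall r e : R, 0 < r -> 0 < e ->
    exists (S : R) (A : X -> {fset (X * nat)}),
      [/\ 0 < S,
          forall x, A x != fset0,
          forall x p, p \in A x -> ball x S p.1
        & forall x y, mdist x y <= r ->
            #|` ((A x `\` A y) `|` (A y `\` A x))%fset |%:R
              < e * #|` (A x `&` A y)%fset |%:R].
Arguments property_A {R} X.

(* Main.v *)
(** Property A is pulled back along [f] without loss. Given [r], let [B] be sets
witnessing Property A of [Y], with radius [s], for a scale that bounds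
[mdist (f x) (f y)] whenever [mdist x y <= r]. Send each [(z, n)] in [B (f x)]
to [(p, k)], where [p] is a chosen point of the [r]-component of [x] in the
preimage of the ball [ball z s], and [k] codes [(z, n)] among the points of
[ball (f p) s], which is finite as [Y] has bounded geometry. Since [z] and [n]
can be read off [(p, k)], this map is injective; when [mdist x y <= r], the
points [x] and [y] lie in the same component for every [(z, n)] in
[B (f x) `&` B (f y)], so the two maps agree there. Coarse lightness bounds the
distance from [x] to [p]. *)

Require Import Defs.
From mathcomp Require Import all_boot all_order all_algebra finmap.
From mathcomp Require Import boolp classical_sets cardinality reals ereal.
From mathcomp Require Import topology.

Set Implicit Arguments.
Unset Strict Implicit.
Unset Printing Implicit Defensive.

Import Order.TTheory GRing.Theory Num.Theory.

Local Open Scope classical_set_scope.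
Local Open Scope ring_scope.

Section FsetImage.
Local Open Scope fset_scope.
Variables (K L : choiceType) (B C : {fset K}) (g h : K -> L).
Hypothesis gh : {in B `&` C, g =1 h}.

(** A point common to [B] and [C] has the same image under both maps, so an element of just one of
    the two images comes from the symmetric difference of [B] and [C]. *)
Lemma card_imfset_symdiff :
  (#|` ([fset g p | p in B] `\` [fset h p | p in C]) `|`
       ([fset h p | p in C] `\` [fset g p | p in B])|
   <= #|` (B `\` C) `|` (C `\` B)|)%N.
Proof.
(* Merging [g] and [h] into one map allows a single count over [D]. *)
pose k p := if p \in B then g p else h p.
set D := (B `\` C) `|` (C `\` B).
apply: (@leq_trans #|` [fset k p | p in D]|); last exact: leq_imfset_card.
apply/fsubset_leq_card/fsubsetP => q.
rewrite in_fsetU !in_fsetD => /orP[] /andP[qN /imfsetP[p /= pB qE]].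
- apply/imfsetP; exists p; last by rewrite /k pB.
  rewrite /D !inE pB/= andbT orbF; apply: contra qN => pC.
  by rewrite qE gh ?inE ?pB//; apply: in_imfset.
- have pNB : p \notin B.
    apply: contra qN => pB'.
    by rewrite qE -gh ?inE ?pB'//; apply: in_imfset.
  by apply/imfsetP; exists p; rewrite /= /D /k ?inE ?(negbTE pNB) ?pB.
Qed.

Lemma card_imfset_inter : {in B &, injective g} ->
  (#|` B `&` C| <= #|` [fset g p | p in B] `&` [fset h p | p in C]|)%N.
Proof.
move=> g_inj; have gI : {in B `&` C &, injective g}.
  by move=> p q /fsetIP[pB _] /fsetIP[qB _]; apply: g_inj.
rewrite -(card_in_imfset imfset_key gI).
apply/fsubset_leq_card/fsubsetP => _ /imfsetP[p /= pBC ->].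
rewrite in_fsetI; apply/andP; split; last rewrite gh//;
  by apply: in_imfset; case/fsetIP: pBC.
Qed.

End FsetImage.

Section Bounded.
Context {R : realType}.
Implicit Type X : metricType R.

Lemma diam_leP X (A : set X) (M : R) :
  (diam A <= M%:E)%E <-> forall x y, A x -> A y -> mdist x y <= M.
Proof.
split=> [AM x y Ax Ay|AM].
- rewrite -lee_fin (le_trans _ AM)//; apply: ereal_sup_ubound.
  by exists (x, y).
- by apply: ge_ereal_sup => _ [[x y] /= [Ax Ay] <-]; rewrite lee_fin AM.
Qed.

(** The largest family with diameter bound [M]: it serves all pairs at distance at most [M] at
    once. *)
Definition diam_le_family X (M : R) : set (set X) :=
  [set A | (diam A <= M%:E)%E].

Lemma diam_le_family_bounded X (M : R) :
  0 < M -> uniformly_bounded (diam_le_family M : set (set X)).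
Proof. by move=> M0; exists M. Qed.

Lemma pair_diam_le X (M : R) (x y : X) :
  0 < M -> mdist x y <= M -> in_common_element (diam_le_family M) x y.
Proof.
move=> M0 xyM; exists [set x; y]; last by split; [left|right].
apply/diam_leP => _ _ [->|->] [->|->] //; rewrite ?mdistxx ?(ltW M0)//.
by rewrite metric_sym.
Qed.

Lemma ball_diam_le X (z : X) (s : R) : diam_le_family (s + s) (ball z s).
Proof.
apply/diam_leP => x y; rewrite ballEmdist/= => zx zy.
by rewrite (le_trans (metric_triangle x z y))// lerD// ltW// metric_sym.
Qed.

Lemma ls_continuous_mdist (X Y : metricType R) (f : X -> Y) (r : R) :
  ls_continuous f -> 0 < r ->
  exists2 t : R, 0 < t & forall x y, mdist x y <= r -> mdist (f x) (f y) <= t.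
Proof.
move=> fc r0; have [t t0 ft] := fc _ (diam_le_family_bounded X r0).
exists t => // x y /(pair_diam_le r0)[W W_r [Wx Wy]].
have /ft/diam_leP : [set f @` A | A in diam_le_family r] (f @` W).
  by exists W.
by apply; [exists x|exists y].
Qed.

(** The sets of diameter at most [s + s] cover [X] and include all balls of radius [s], so one [n]
    bounds the size of every such ball. *)
Lemma bounded_geometry_ball_code X (s : R) : bounded_geometry X -> 0 < s ->
  exists c : X -> X -> nat, forall x, {in (ball x s : set X) &, injective (c x)}.
Proof.
move=> bg s0; have s2 : 0 < s + s by rewrite addr_gt0.
have [|n nP] := bg _ (diam_le_family_bounded X s2).
  rewrite -subTset => x _; exists (ball x s : set X); first exact: ball_diam_le.
  by rewrite ballEmdist/= mdistxx.
suff /choice[c cP] : forall x, exists c : X -> nat, {in (ball x s : set X) &, injective c}.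
  by exists c.
move=> x; apply/pcard_injP.
by apply: (card_le_trans (nP _ (ball_diam_le x s))); apply: subset_card_le.
Qed.

End Bounded.

Section Component.
Context {T : choiceType}.
Variables (U : set (set T)) (A : set T).

Definition component (x : T) : set T := [set y | joined U A x y].

Lemma component_refl x : A x -> component x x.
Proof. by move=> Ax; exists [::]; split=> // z; rewrite inE => /eqP->. Qed.

Lemma component_sub x : component x `<=` A.
Proof. by move=> _ [s [sA _ <-]]; apply: sA; rewrite mem_last. Qed.

Lemma eq_component x y :
  A x -> A y -> in_common_element U x y -> component x = component y.
Proof.
have sub a b : A a -> in_common_element U a b -> component b `<=` component a.
  move=> Aa ab z [s [sA sU sz]]; exists (b :: s); split=> //.
  - by move=> w; rewrite inE => /predU1P[->//|]; apply: sA.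
  - by rewrite /= sU andbT; apply/asboolP.
move=> Ax Ay xy; apply/seteqP; split; apply: sub => //.
by case: xy => W UW [Wx Wy]; exists W.
Qed.

Definition representative (x : T) : T := xget x (component x).

Lemma representativeP x : A x -> component x (representative x).
Proof. by move=> Ax; apply: xgetPex; exists x; apply: component_refl. Qed.

Lemma eq_representative x y :
  A x -> A y -> in_common_element U x y -> representative x = representative y.
Proof.
move=> Ax Ay xy; rewrite /representative (eq_component Ax Ay xy) /xget.
(* The two choices differ only in their defaults [x] and [y], which are not reached since the
   component contains [y]. *)
case: pselect => // -[]; exists y; apply/asboolP.
exact: component_refl.
Qed.

End Component.

(** Every family refines itself, so this one belongs to the light structure. *)
Lemma coarsely_light_component (R : realType) (X Y : metricType R) (f : X -> Y)
    (U : set (set X)) (V : set (set Y)) :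
  coarsely_light f -> uniformly_bounded U -> uniformly_bounded V ->
  uniformly_bounded (component_family U f V).
Proof.
move=> fl U_b V_b; suff : ls_structure X (component_family U f V) by [].
by rewrite -fl; exists U, V; split=> // A ? _; exists A.
Qed.

Theorem corollary9p4 (R : realType) (X Y : metricType R) (f : X -> Y)
  (bgX : bounded_geometry X) (bgY : bounded_geometry Y)
  (f_cont : ls_continuous f) (f_light : coarsely_light f)
  (Y_A : property_A Y) :
  property_A X.
Proof.
move=> r e r0 e0.
have [t t0 ft] := ls_continuous_mdist f_cont r0.
have [s [B [s0 B0 Bs Bt]]] := Y_A t e t0 e0.
have [c c_inj] := bounded_geometry_ball_code bgY s0.
have s2 : 0 < s + s by rewrite addr_gt0.
have [M M0 MP] := coarsely_light_component f_light
  (diam_le_family_bounded X r0) (diam_le_family_bounded Y s2).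
pose U : set (set X) := diam_le_family r.
pose pre z := f @^-1` ball z s.
pose rep z x := representative U (pre z) x.
pose g x (q : Y * nat) := (rep q.1 x, choice.pickle (c (f (rep q.1 x)) q.1, q.2)).
have preB x q : q \in B (f x) -> pre q.1 x.
  by move=> /Bs/ball_sym.
have rep_ball x q : q \in B (f x) -> q.1 \in (ball (f (rep q.1 x)) s : set Y).
  move=> /preB/(representativeP U)/component_sub.
  by rewrite inE => /ball_sym.
have g_inj x : {in B (f x) &, injective (g x)}.
  move=> [z n] [w m] /rep_ball zB /rep_ball wB [] /= repE.
  move=> /(pcan_inj choice.pickleK)[+ ->].
  (* By [repE] both [z] and [w] lie in the ball about one and the same point, where the code is
     injective. *)
  rewrite -repE in wB * => /c_inj-> //.
have gE x y : mdist x y <= r -> {in (B (f x) `&` B (f y))%fset, g x =1 g y}.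
  move=> xyr q /fsetIP[/preB xq /preB yq].
  suff repE : rep q.1 x = rep q.1 y by rewrite /g repE.
  by apply: eq_representative => //; apply: pair_diam_le.
(* Balls are open while [M] is a non-strict bound, hence [M + 1]. *)
exists (M + 1), (fun x => [fset g x q | q in B (f x)]%fset); split.
- by rewrite addr_gt0.
- move=> x; have /fset0Pn[q qB] := B0 (f x).
  by apply/fset0Pn; exists (g x q); apply: in_imfset.
- move=> x _ /imfsetP[q /= /preB xq ->].
  rewrite ballEmdist/= (@le_lt_trans _ _ M) ?ltrDl//.
  have /MP/diam_leP : component_family U f (diam_le_family (s + s))
      (component U (pre q.1) x).
    by exists (ball q.1 s); [exact: ball_diam_le | exists x].
  by apply; [exact: component_refl | exact: representativeP].
(* Passing to images does not enlarge the symmetric difference or shrink the intersection, so the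
   estimate in [Y] carries over with the same [e]. *)
- move=> x y xyr; apply: le_lt_trans (lt_le_trans (Bt _ _ (ft _ _ xyr)) _).
    by rewrite ler_nat; apply: card_imfset_symdiff; apply: gE.
  by rewrite ler_pM2l// ler_nat; apply: card_imfset_inter => //; apply: gE.
Qed.
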